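(* Let $d\ge1$, $r\in(0,+\infty)$, let $\|\cdot\|$ be a norm on $\mathbb{R}^d$. Assume $P=h\cdot\lambda_d$ with $h\in L^{\frac{d}{d+r}}(\lambda_d)$ and $\int\|x\|^r\,dP(x)<+\infty$. Let $(a_n)_{n\ge1}$ be an $L^r$-optimal greedy quantization sequence for $P$, $a^{(n)}=\{a_1,\dots,a_n\}$, so that $a_1$ is an $L^r$-median of $P$. Assume $\operatorname{supp}(P)\subset A$ and $a_1\in A$ for some set $A$ which is star-shaped with respect to $a_1$ and peakless with respect to $a_1$ in the sense that $$\mathfrak{p}(A,\|\cdot-a_1\|):=\inf\Big\{\frac{\lambda_d(B(x,t)\cap A)}{\lambda_d(B(x,t))}:\ x\in A,\ 0<t\le\|x-a_1\|\Big\}>0.$$ Assume $h$ is almost radial non-increasing on $A$ with respect to $a_1$, with associated norm $\|\cdot\|_0$ and constant $M\in(0,1]$, and let $C_0\in[1,+\infty)$ be such that $\frac1{C_0}\|x\|_0\le\|x\|\le C_0\|x\|_0$ for all $x\in\mathbb{R}^d$. Then $$\forall n\ge2,\quad e_r(a^{(n)},P)\le\kappa^{\mathrm{G,Z,P}}_{d,r,M,C_0,\mathfrak{p}(A,\|\cdot-a_1\|)}\ \|h\|^{\frac1r}_{L^{\frac{d}{d+r}}(\lambda_d)}(n-1)^{-\frac1d},$$ where $$\kappa^{\mathrm{G,Z,P}}_{d,r,M,C_0,\mathfrak{p}(A,\|\cdot-a_1\|)}\le\frac{2C_0^2\,r^{\frac1d}}{d^{\frac1d}M^{d+r}V_d^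{\frac1d}\mathfrak{p}(A,\|\cdot-a_1\|)^{\frac1d}}\min_{\varepsilon\in(0,\frac13)}\varphi_r(\varepsilon)^{-\frac1d}.$$
   Context: For a finite nonempty $\Gamma\subset\mathbb{R}^d$, $d(x,\Gamma)=\min_{a\in\Gamma}\|x-a\|$ and $e_r(\Gamma,P)=\big(\int d(x,\Gamma)^r dP(x)\big)^{1/r}$. An $L^r$-optimal greedy quantization sequence for $P$ is a sequence $(a_n)_{n\ge1}$ with $a_{n+1}\in\operatorname{argmin}_{\xi}e_r(a^{(n)}\cup\{\xi\},P)$ for all $n\ge0$, $a^{(0)}=\varnothing$, $a^{(n)}=\{a_1,\dots,a_n\}$. $B(x,t)=\{y:\|y-x\|\le t\}$, $\lambda_d$ Lebesgue measure, $V_d=\lambda_d(B(0,1))$, $\varphi_r(u)=(3^{-r}-u^r)u^d$, $\|h\|_{L^{p}(\lambda_d)}=(\int h^p d\lambda_d)^{1/p}$. A function $f:\mathbb{R}^d\to\mathbb{R}_+$ is almost radial non-increasing on $A$ with respect to $a\in A$ if there exist a norm $\|\cdot\|_0$ on $\mathbb{R}^d$ and a constant $M\in(0,1]$ such that for all $x,y\in A\setminus\{a\}$ with $\|y-a\|_0\le\|x-a\|_0$, one has $f(y)\ge Mf(x)$. *)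

(* Defs.v *)
From HB Require Import structures.
From mathcomp Require Import all_boot all_order all_algebra.
From mathcomp Require Import all_classical all_reals all_analysis.
Set Implicit Arguments. Unset Strict Implicit. Unset Printing Implicit Defensive.
Import Order.TTheory GRing.Theory Num.Theory.
Import numFieldNormedType.Exports.
Local Open Scope classical_set_scope.
Local Open Scope ring_scope.

Definition Rd (R : realType) (d : nat) :=
  g_sigma_algebraType (@open ('rV[R]_d)).

Definition is_norm (R : realType) (d : nat) (N : 'rV[R]_d -> R) : Prop :=
  [/\ forall x, N x = 0 -> x = 0,
      forall (a : R) x, N (a *: x) = `|a| * N x
    & forall x y, N (x + y) <= N x + N y].

Definition nball (R : realType) (d : nat) (N : 'rV[R]_d -> R) (x : 'rV[R]_d)
  (t : R) : set (Rd R d) := [set y | N (y - x) <= t].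

(* lam is Lebesgue measure on the Borel sets of R^d: a measure giving every
   closed box its volume (this determines it uniquely on Borel sets). *)
Definition is_lebesgue (R : realType) (d : nat)
  (lam : {measure set (Rd R d) -> \bar R}) : Prop :=
  forall a b : 'rV[R]_d, (forall i, a ord0 i <= b ord0 i) ->
    lam [set x : Rd R d | forall i, a ord0 i <= x ord0 i <= b ord0 i]
      = (\prod_(i < d) (b ord0 i - a ord0 i))%:E.

(* d(x, Gamma) for a finite nonempty Gamma given as a nonempty list. *)
Definition distN (R : realType) (d : nat) (N : 'rV[R]_d -> R)
  (x : 'rV[R]_d) (G : seq 'rV[R]_d) : R :=
  foldr (fun a m => Num.min (N (x - a)) m) (N (x - head 0 G)) G.

Definition err (R : realType) (d : nat) (N : 'rV[R]_d -> R)
  (lam : {measure set (Rd R d) -> \bar R}) (h : Rd R d -> R) (r : R)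
  (G : seq 'rV[R]_d) : \bar R :=
  ((\int[lam]_x ((distN N x G) `^ r * h x)%:E) `^ r^-1)%E.

(* a^(n) = {a_1, ..., a_n}, where a_k is  a (k - 1). *)
Definition apref (R : realType) (d : nat) (a : nat -> 'rV[R]_d) (n : nat) :=
  map a (iota 0 n).

Definition greedy_seq (R : realType) (d : nat) (N : 'rV[R]_d -> R)
  (lam : {measure set (Rd R d) -> \bar R}) (h : Rd R d -> R) (r : R)
  (a : nat -> 'rV[R]_d) : Prop :=
  forall (n : nat) (xi : 'rV[R]_d),
    (err N lam h r (apref a n.+1) <= err N lam h r (rcons (apref a n) xi))%E.

Definition supp (R : realType) (d : nat)
  (lam : {measure set (Rd R d) -> \bar R}) (h : Rd R d -> R) : set 'rV[R]_d :=
  [set x | forall U : set 'rV[R]_d, open U -> U x ->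
     (0 < \int[lam]_(y in (U : set (Rd R d))) (h y)%:E)%E].

Definition star_shaped (R : realType) (d : nat) (A : set 'rV[R]_d)
  (c : 'rV[R]_d) : Prop :=
  forall x, A x -> forall t : R, 0 <= t <= 1 -> A (c + t *: (x - c)).

Definition peakless_const (R : realType) (d : nat) (N : 'rV[R]_d -> R)
  (lam : {measure set (Rd R d) -> \bar R}) (A : set (Rd R d)) (c : 'rV[R]_d)
  : R :=
  inf [set q : R | exists (x : 'rV[R]_d) (t : R),
      [/\ A x, 0 < t, t <= N (x - c) &
       q = fine (lam (nball N x t `&` A)) / fine (lam (nball N x t))]].

Definition almost_radial_nonincr (R : realType) (d : nat) (h : Rd R d -> R)
  (A : set 'rV[R]_d) (c : 'rV[R]_d) (N0 : 'rV[R]_d -> R) (M : R) : Prop :=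
  forall x y, A x -> x <> c -> A y -> y <> c ->
    N0 (y - c) <= N0 (x - c) -> M * h x <= h y.

Definition phi_r (R : realType) (d : nat) (r u : R) : R :=
  (3 `^ (- r) - u `^ r) * u ^+ d.

(* Main.v *)
(* Let D be the distance to the first n points, u_n the integral of D^r h,
   al = d / (d + r) and Z the integral of h^al.  Adding a point xi lowers u_n by
   at least (1 - eps^r) times the integral of D^r h over the y with
   ||xi - y|| <= eps D(y), and the greedy choice does at least as well as every
   xi.  Average this over xi with weight h^al and exchange the integrals: since h
   is almost radial non-increasing and A is peakless, the h^al-mass of the ball
   B(y, eps D(y)) is at least a constant times h(y)^al D(y)^d.  Hence
   Z (u_n - u_{n+1}) >= c I, with I the integral of D^(r+d) h^(1+al), and
   Hoelder's inequality u_n <= I^(1-al) Z^al turns this into the recursion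
   u_n^(1+d/r) <= K (u_n - u_{n+1}), whose solutions decay like n^(-r/d). *)

Require Import Defs.
From HB Require Import structures.
From mathcomp Require Import all_boot all_order all_algebra.
From mathcomp Require Import all_classical all_reals all_analysis.
From mathcomp Require Import measurable_realfun ring lra.
Import Order.TTheory GRing.Theory Num.Theory.
Import numFieldNormedType.Exports.
Local Open Scope classical_set_scope.
Local Open Scope ring_scope.

Set Implicit Arguments. Unset Strict Implicit. Unset Printing Implicit Defensive.

(** * Borel sets of R^d and Lebesgue measure *)

Section boxes.
Context {R : realType} {d : nat}.
Implicit Types (a b x : 'rV[R]_d).

Definition cbox a b : set (Rd R d) :=
  [set x : Rd R d | forall i, a ord0 i <= x ord0 i <= b ord0 i].

Definition cboxes : set (set (Rd R d)) :=
  [set B | exists a b, B = cbox a b].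

Lemma measurable_open (U : set 'rV[R]_d) : open U ->
  measurable (U : set (Rd R d)).
Proof. exact: sub_sigma_algebra. Qed.

Lemma measurable_continuous (f : 'rV[R]_d -> R) : continuous f ->
  measurable_fun setT (f : Rd R d -> R).
Proof.
move=> /continuousP cf; apply: (measurability _ (RGenOpens.measurableE R)).
move=> _ [_ [x [y ->] <-]]; rewrite setTI.
by apply: measurable_open; apply: cf; exact: interval_open.
Qed.

Lemma measurable_coord (i : 'I_d) :
  measurable_fun setT (fun x : Rd R d => x ord0 i : R).
Proof. by apply: measurable_continuous; exact: coord_continuous. Qed.

Lemma cbox_bigcap a b : cbox a b =
  \bigcap_(i in [set: 'I_d])
     (fun x : Rd R d => x ord0 i) @^-1` `[a ord0 i, b ord0 i].
Proof.
by apply/seteqP; split => [x xab i _|x xab i]; have := xab i; rewrite /= in_itv//=; exact.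
Qed.

Lemma measurable_cbox a b : measurable (cbox a b).
Proof.
rewrite cbox_bigcap; apply: fin_bigcap_measurable => // i _.
by rewrite -[X in measurable X]setTI; apply: measurable_coord.
Qed.

(** Around each point of [U] fits a box with rational corners inside [U]. There are only countably
    many such boxes, so questions about open sets reduce to boxes, both for the sigma-algebra and
    for the support. *)
Lemma open_bigcup_cbox (U : set 'rV[R]_d) : open U -> U =
  \bigcup_(c in [set c : 'rV[rat]_d * 'rV[rat]_d |
      cbox (map_mx ratr c.1) (map_mx ratr c.2) `<=` U])
    cbox (map_mx ratr c.1) (map_mx ratr c.2).
Proof.
move=> oU; apply/seteqP; split => [x Ux|x [c /= cU xc]]; last exact: cU.
have /nbhs_ballP[e /= e0 eU] : nbhs x U by exact: open_nbhs_nbhs.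
have /choice[p pP] : forall i : 'I_d, exists q : rat,
    ratr q \in `]x ord0 i - e, x ord0 i[%R.
  by move=> i; apply: rat_in_itvoo; rewrite ltrBlDr ltrDl.
have /choice[q qP] : forall i : 'I_d, exists q : rat,
    ratr q \in `]x ord0 i, x ord0 i + e[%R.
  by move=> i; apply: rat_in_itvoo; rewrite ltrDl.
exists (\row_i p i, \row_i q i) => /=; last first.
  move=> i; rewrite !mxE; have := pP i; have := qP i.
  by rewrite !in_itv/= => /andP[/ltW -> _] /andP[_ /ltW ->].
move=> y yc; apply: eU; split => // i j; rewrite (ord1 i) /ball/=.
have := yc j; rewrite !mxE; have := pP j; have := qP j.
rewrite !in_itv/= => /andP[_ q1] /andP[p1 _] /andP[y1 y2].
by rewrite ltr_norml; lra.
Qed.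

(** [is_lebesgue] prescribes values on closed boxes only, so these have to generate the Borel sets;
    they do because open sets are countable unions of rational boxes. *)
Lemma sigma_cboxes : (measurable : set (set (Rd R d))) = <<s cboxes >>.
Proof.
apply/seteqP; split; apply: smallest_sub.
- exact: smallest_sigma_algebra.
- move=> U oU; rewrite (open_bigcup_cbox oU) bigcup_mkcond.
  pose T := g_sigma_algebraType cboxes.
  apply: (@countable_bigcupT_measurable _ T); first exact: countableP.
  move=> c; case: ifP => _; last exact: measurable0.
  by apply: sub_sigma_algebra; exists (map_mx ratr c.1), (map_mx ratr c.2).
- exact: sigma_algebra_measurable.
- by move=> _ [a [b ->]]; exact: measurable_cbox.
Qed.

(** Preimages of boxes are finite intersections of coordinate preimages. On a product space this
    gives measurability of differences for the product sigma-algebra, without using a topology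
    there. *)
Lemma measurable_coordP (d' : measure_display) (T : measurableType d')
    (f : T -> Rd R d) :
  (forall i, measurable_fun setT (fun t => f t ord0 i : R)) ->
  measurable_fun setT f.
Proof.
move=> mf; apply: (measurability _ sigma_cboxes) => _ [_ [a [b ->] <-]].
rewrite setTI cbox_bigcap preimage_bigcap.
apply: fin_bigcap_measurable => // i _.
by rewrite -[X in measurable X]setTI; exact: mf.
Qed.

Lemma cboxI a b a' b' : cbox a b `&` cbox a' b' =
  cbox (\row_i Num.max (a ord0 i) (a' ord0 i))
       (\row_i Num.min (b ord0 i) (b' ord0 i)).
Proof.
apply/seteqP; split => [x [xab xab'] i|x xab].
  have /andP[a1 b1] := xab i; have /andP[a2 b2] := xab' i.
  by rewrite !mxE ge_max le_min; apply/andP; split; apply/andP.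
split=> i; have := xab i; rewrite !mxE ge_max le_min.
  by move=> /andP[/andP[a1 _] /andP[b1 _]]; apply/andP.
by move=> /andP[/andP[_ a1] /andP[_ b1]]; apply/andP.
Qed.

Lemma cbox_eq0 a b i : b ord0 i < a ord0 i -> cbox a b = set0.
Proof.
move=> ba; apply/seteqP; split => // x /(_ i) /andP[ax xb].
by have := le_trans ax xb; rewrite leNgt ba.
Qed.

Lemma bigcup_cboxT :
  \bigcup_n cbox (const_mx (- n%:R)) (const_mx n%:R) = setT.
Proof.
apply/seteqP; split => // x _.
have [n xn] : exists n : nat, (`|x : 'rV[R]_d| <= n%:R).
  by exists (Num.trunc `|x : 'rV[R]_d|).+1; rewrite ltW// truncnS_gt.
exists n => // i; rewrite !mxE -ler_norml.
apply: le_trans xn; rewrite [leRHS]/Num.norm/= mx_normrE.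
by apply: (le_trans _ (le_bigmax _ _ (ord0, i))).
Qed.

End boxes.

Section lebesgue.
Context {R : realType} {d : nat} (lam : {measure set (Rd R d) -> \bar R}).
Hypothesis lamP : is_lebesgue lam.

Lemma lebesgue_cbox_lty (a b : 'rV[R]_d) : (lam (cbox a b) < +oo)%E.
Proof.
have [ab|/existsNP[i /negP]] := pselect (forall i, a ord0 i <= b ord0 i).
  by rewrite lamP// ltry.
by rewrite -ltNge => /cbox_eq0 ->; rewrite measure0.
Qed.

Lemma lebesgue_sigma_finite : sigma_finite setT lam.
Proof.
exists (fun n => cbox (const_mx (- n%:R)) (const_mx n%:R)).
  by rewrite bigcup_cboxT.
by move=> n; split; [exact: measurable_cbox|exact: lebesgue_cbox_lty].
Qed.

(** Boxes are stable under intersection ([cboxI]) and boxes of finite measure exhaust the space, so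
    agreement on boxes extends to the generated sigma-algebra. *)
Lemma lebesgue_unique (mu : {measure set (Rd R d) -> \bar R}) :
  is_lebesgue mu -> forall B, measurable B -> lam B = mu B.
Proof.
move=> muP; apply: (@measure_unique _ _ _ cboxes
  (fun n => cbox (const_mx (- n%:R)) (const_mx n%:R))).
- exact: sigma_cboxes.
- move=> _ _ [a [b ->]] [a' [b' ->]].
  by rewrite cboxI; eexists; eexists; reflexivity.
- by move=> n; eexists; eexists; reflexivity.
- exact: bigcup_cboxT.
- move=> _ [a [b ->]].
  (* A box with some b_i < a_i is not covered by [is_lebesgue], but it is empty. *)
  have [ab|/existsNP[i /negP]] := pselect (forall i, a ord0 i <= b ord0 i).
    by rewrite lamP// muP.
  by rewrite -ltNge => /cbox_eq0 ->; rewrite !measure0.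
- by move=> n; exact: lebesgue_cbox_lty.
Qed.

Lemma measurable_affine (x : 'rV[R]_d) (t : R) :
  measurable_fun setT (fun y : Rd R d => (x + t *: (y : 'rV[R]_d)) : Rd R d).
Proof.
apply: measurable_coordP => i; under eq_fun do rewrite !mxE.
by apply: measurable_funD => //; apply: measurable_funM => //; exact: measurable_coord.
Qed.

(** The pushforward of [lam] by y -> x + t y, scaled by t^d, gives each box its volume, since the
    preimage of a box is a box with sides divided by t. Uniqueness identifies it with [lam]. *)
Lemma lebesgue_affine (x : 'rV[R]_d) (t : R) : 0 < t ->
  forall B, measurable B ->
  lam B = ((t ^+ d)%:E *
    lam [set y : Rd R d | B ((x + t *: (y : 'rV[R]_d))%R : Rd R d)])%E.
Proof.
move=> t0 B mB; have td : 0 <= t ^+ d by rewrite exprn_ge0 ?ltW.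
pose f (y : Rd R d) : Rd R d := x + t *: (y : 'rV[R]_d).
pose mf : measurable_fun setT f := measurable_affine x t.
pose mu : {measure set (Rd R d) -> \bar R} :=
  mscale (NngNum td) (pushforward lam f : {measure set _ -> \bar R}).
suff muP : is_lebesgue (mu mf) by rewrite (lebesgue_unique muP mB).
move=> a b ab.
have E : f @^-1` cbox a b = cbox (t^-1 *: (a - x)) (t^-1 *: (b - x)).
  have H (u v w : R) : (u <= w + t * v) = (t^-1 * (u - w) <= v).
    by rewrite -lerBlDl ler_pdivrMl.
  have H' (u v w : R) : (w + t * v <= u) = (v <= t^-1 * (u - w)).
    by rewrite -lerBrDl ler_pdivlMl.
  by apply/seteqP; split => y yab i; have := yab i; rewrite /f !mxE H H'.
rewrite /mu/= /mscale/= /pushforward [X in lam X]E lamP; last first.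
  by move=> i; rewrite !mxE ler_pM2l ?invr_gt0// lerB.
rewrite -EFinM; congr EFin.
rewrite (eq_bigr (fun i => t^-1 * (b ord0 i - a ord0 i))); last first.
  by move=> i _; rewrite !mxE; ring.
by rewrite big_split/= prodr_const card_ord mulrA -exprMn divff ?gt_eqF// expr1n mul1r.
Qed.


End lebesgue.

(** * Norms on R^d: continuity, measurability, balls, distance to a finite set *)

Section norms.
Context {R : realType} {d : nat} (N : 'rV[R]_d -> R).
Hypothesis NP : is_norm N.
Implicit Types (x y z : 'rV[R]_d) (t : R).

Lemma is_normZ t x : N (t *: x) = `|t| * N x.
Proof. by have [_ ->] := NP. Qed.

Lemma is_normD x y : N (x + y) <= N x + N y.
Proof. by have [_ _] := NP; exact. Qed.

Lemma is_norm0 : N 0 = 0.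
Proof. by rewrite -(scale0r 0) is_normZ normr0 mul0r. Qed.

Lemma is_normN x : N (- x) = N x.
Proof. by rewrite -scaleN1r is_normZ normrN1 mul1r. Qed.

Lemma is_normB x y : N (x - y) = N (y - x).
Proof. by rewrite -is_normN opprB. Qed.

Lemma is_norm_ge0 x : 0 <= N x.
Proof.
have := is_normD x (- x); rewrite subrr is_norm0 is_normN -mulr2n.
by rewrite pmulrn_lge0.
Qed.

Lemma is_norm_tri z x y : N (x - y) <= N (x - z) + N (z - y).
Proof. by apply: le_trans (is_normD _ _); rewrite addrA subrK. Qed.

Lemma is_norm_lip x y : `|N x - N y| <= N (x - y).
Proof.
rewrite ler_norml; have := is_normD (x - y) y; have := is_normD (y - x) x.
by rewrite !subrK (is_normB y) => *; lra.
Qed.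

Lemma is_norm_sum (s : seq 'I_d) (F : 'I_d -> 'rV[R]_d) :
  N (\sum_(i <- s) F i) <= \sum_(i <- s) N (F i).
Proof.
elim: s => [|i s IH]; first by rewrite !big_nil is_norm0.
by rewrite !big_cons (le_trans (is_normD _ _))// lerD2l.
Qed.

Lemma is_norm_bounded : exists2 C : R, 0 < C & forall x, N x <= C * `|x|.
Proof.
exists (1 + \sum_i N (delta_mx ord0 i)) => [|x].
  by rewrite ltr_wpDr// sumr_ge0// => i _; exact: is_norm_ge0.
rewrite {1}(row_sum_delta x) (le_trans (is_norm_sum _ _))//.
rewrite mulrDl mul1r ler_wpDl// mulr_suml ler_sum// => i _.
rewrite is_normZ mulrC ler_wpM2l ?is_norm_ge0//.
rewrite [leRHS]/Num.norm/= mx_normrE.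
by apply: (le_trans _ (le_bigmax _ _ (ord0, i))).
Qed.

Lemma is_norm_continuous : continuous N.
Proof.
have [C C0 NC] := is_norm_bounded.
move=> x B /nbhs_ballP[e /= e0 eB]; change (nbhs x (N @^-1` B)).
apply/nbhs_ballP; exists (e / C) => /=; first by rewrite divr_gt0.
move=> y; rewrite -ball_normE /= => xy; apply: eB; rewrite /ball/=.
rewrite (le_lt_trans (is_norm_lip _ _))// (le_lt_trans (NC _))//.
by rewrite -ltr_pdivlMl// mulrC.
Qed.

Lemma measurable_is_norm : measurable_fun setT (N : Rd R d -> R).
Proof. by apply: measurable_continuous; exact: is_norm_continuous. Qed.

Lemma measurable_is_normB (d' : measure_display) (T : measurableType d')
    (f g : T -> Rd R d) : measurable_fun setT f -> measurable_fun setT g ->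
  measurable_fun setT (fun u => N ((f u : 'rV[R]_d) - (g u : 'rV[R]_d))).
Proof.
move=> mf mg; pose k u : Rd R d := (f u : 'rV[R]_d) - (g u : 'rV[R]_d).
suff mk : measurable_fun setT k.
  exact: (@measurableT_comp _ _ _ _ _ _ (N : Rd R d -> R) _ k measurable_is_norm mk).
apply: measurable_coordP => i; under eq_fun do rewrite !mxE.
by apply: measurable_funB; exact: (measurableT_comp (measurable_coord i)).
Qed.

Lemma measurable_nball x t : measurable (nball N x t).
Proof.
rewrite /nball -[X in measurable X]setTI.
apply: measurable_fun_le => //.
by apply: measurable_is_normB => //; exact: measurable_cst.
Qed.

Lemma lebesgue_nball (lam : {measure set (Rd R d) -> \bar R}) x t :
  is_lebesgue lam -> 0 < t ->
  lam (nball N x t) = ((t ^+ d)%:E * lam (nball N 0 1))%E.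
Proof.
move=> lamP t0; rewrite (lebesgue_affine lamP x t0); last exact: measurable_nball.
congr (_ * lam _)%E; apply/seteqP; split => y; rewrite /nball/= subr0.
  by rewrite addrC addKr is_normZ gtr0_norm// -ler_pdivlMl// mulVf ?gt_eqF.
by rewrite addrC addKr is_normZ gtr0_norm// -ler_pdivlMl// mulVf ?gt_eqF.
Qed.

(** The list must be nonempty: the base value of the fold is then the distance to its head, which
    appending a point at the end does not change. *)
Lemma distN_rcons y a G z :
  distN N y (rcons (a :: G) z) = Num.min (distN N y (a :: G)) (N (y - z)).
Proof.
rewrite /distN /= -minA; congr Num.min; move: (N (y - a)) => c.
by elim: G => [|b G IH] /=; rewrite ?IH ?minA// minC.
Qed.

Lemma distN_le_head y a G : distN N y (a :: G) <= N (y - a).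
Proof. by rewrite /distN /= ge_min lexx. Qed.

Lemma distN_ge0 y G : 0 <= distN N y G.
Proof.
rewrite /distN; move: (head 0 G) => b.
by elim: G => [|a G IH] /=; rewrite ?le_min ?IH !is_norm_ge0.
Qed.

Lemma measurable_distN G : measurable_fun setT (fun y : Rd R d => distN N y G).
Proof.
rewrite /distN; move: (head 0 G) => b.
elim: G => [|a G IH] /=.
  by apply: measurable_is_normB => //; exact: measurable_cst.
apply: measurable_minr => //.
by apply: measurable_is_normB => //; exact: measurable_cst.
Qed.

End norms.

(** * Vanishing of the density outside its support *)

Section support.
Context {R : realType} {d : nat} (lam : {measure set (Rd R d) -> \bar R}).

(** A point outside the support lies in a rational box on which [h] has integral 0, and [h] vanishes
    almost everywhere on each of these countably many boxes. *)
Lemma supp_ae (h : Rd R d -> R) : measurable_fun setT h ->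
  (forall x, 0 <= h x) ->
  lam.-negligible [set x : Rd R d | ~ supp lam h x /\ h x <> 0].
Proof.
move=> mh h0.
pose box (c : 'rV[rat]_d * 'rV[rat]_d) : set (Rd R d) :=
  cbox (map_mx ratr c.1) (map_mx ratr c.2).
(* [F] enumerates the rational boxes through [pickle]; each box of zero integral contributes its
   points with h <> 0, a null set. *)
pose F n := if unpickle n is Some c then
  if (\int[lam]_(y in box c) (h y)%:E == 0)%E then box c `&` [set y | h y <> 0]
  else set0 else set0.
apply: (@negligibleS _ _ _ _ (\bigcup_n F n)); last first.
  apply: negligible_bigcup => n; rewrite /F.
  case: unpickle => [c|]; last exact: negligible_set0.
  case: eqP => [c0|_]; last exact: negligible_set0.
  have mE : measurable_fun (box c) (fun y => (h y)%:E).
    apply: measurable_funTS; exact/measurable_EFinP.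
  have /(ae_eq_integral_abs lam (measurable_cbox _ _) mE) [B [mB B0 sB]] :
      (\int[lam]_(y in box c) `|(h y)%:E| = 0)%E.
    by rewrite -c0; apply: eq_integral => y _; rewrite gee0_abs ?lee_fin.
  exists B; split => // y [cy hy]; apply: sB => /= H.
  by apply: hy; have [] := H cy.
move=> x [/existsNP[U /not_implyP[oU /not_implyP[Ux /negP U0]]] hx].
move: U0 Ux; rewrite -leNgt => U0; rewrite {1}(open_bigcup_cbox oU) => -[c /= cU xc].
exists (pickle c) => //; rewrite /F pickleK.
suff -> : (\int[lam]_(y in box c) (h y)%:E)%E = 0%E by rewrite eqxx.
apply/eqP; rewrite eq_le integral_ge0 ?andbT; last first.
  by move=> y _; rewrite lee_fin.
apply: le_trans U0; apply: ge0_subset_integral => //.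
- exact: measurable_cbox.
- exact: measurable_open.
- by apply: measurable_funTS; exact/measurable_EFinP.
- by move=> y _; rewrite lee_fin.
Qed.

End support.

(** * A recursive inequality *)

(** The convex function q^(-s) lies above its tangent at q = 1; this follows from exp x >= 1 + x and
    ln q <= q - 1. *)
Lemma powRN_ge (R : realType) (s q : R) : 0 < s -> 0 < q ->
  1 + s * (1 - q) <= q `^ (- s).
Proof.
move=> s0 q0; rewrite /powR gt_eqF//.
apply: le_trans (expR_ge1Dx _).
have : ln (1 + (q - 1)) <= q - 1 by apply: le_ln1Dx; lra.
rewrite addrC subrK => lq; rewrite lerD2l mulNr -mulrN ler_pM2l//; lra.
Qed.

(* Summing [w k.+1 `^ (- s) - w k `^ (- s) >= s / K], a consequence of the
   convexity of [x `^ (- s)]. *)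
Lemma recursive_decay (R : realType) (s K : R) (w : nat -> R) :
  0 < s -> 0 <= K -> (forall n, 0 <= w n) ->
  (forall n, w n `^ (1 + s) <= K * (w n - w n.+1)) ->
  forall n, 0 < w n -> s * n%:R <= K * w n `^ (- s).
Proof.
move=> s0 K0 w0 wK.
elim=> [|n IH] wS; first by rewrite mulr0 mulr_ge0 ?powR_ge0.
have {}K0 : 0 < K.
  rewrite lt_neqAle K0 andbT; apply/eqP => KE.
  have := wK n.+1; rewrite -KE mul0r leNgt => /negP; apply.
  exact: powR_gt0.
have wn : w n.+1 <= w n.
  rewrite -subr_ge0 -(pmulr_rge0 _ K0); apply: le_trans (wK n).
  exact: powR_ge0.
have wn0 : 0 < w n by exact: lt_le_trans wn.
have wSE : w n.+1 = w n * (w n.+1 / w n) by rewrite mulrC divfK ?gt_eqF.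
rewrite wSE powRM ?divr_ge0//.
(* The induction hypothesis covers s n, and the recursion at n gives the increment s, since w^(-s) /
   w is the inverse of w^(1 + s). The passage to w n.+1 is [powRN_ge] at the ratio w n.+1 / w n. *)
apply: (@le_trans _ _ (K * (w n `^ (- s) * (1 + s * (1 - w n.+1 / w n))))).
  rewrite mulrDr mulr1 mulrDr -natr1 mulrDr mulr1 lerD ?IH//.
  rewrite (_ : K * _ = s * w n `^ (- s) / w n * (K * (w n - w n.+1))); last first.
    by field; rewrite gt_eqF.
  rewrite -[leLHS]mulr1 -!mulrA ler_pM2l//.
  apply: (@le_trans _ _ (w n `^ (- s) * ((w n)^-1 * w n `^ (1 + s)))); last first.
    by rewrite !ler_wpM2l ?powR_ge0// invr_ge0 ltW.
  have -> : w n `^ (1 + s) = w n * w n `^ s.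
    by rewrite powRD ?powRr1//; rewrite (gt_eqF wn0) implybT.
  rewrite powRN.
  by rewrite mulKf ?gt_eqF// mulVf// gt_eqF// powR_gt0.
rewrite ler_pM2l// ler_pM2l ?powR_gt0//.
by apply: powRN_ge => //; rewrite divr_gt0.
Qed.

(** * Balls and peakless sets *)

Section peakless.
Context {R : realType} {d : nat} (N : 'rV[R]_d -> R).
Context (lam : {measure set (Rd R d) -> \bar R}) (A : set (Rd R d)).
Context (c : 'rV[R]_d).
Hypotheses (NP : is_norm N) (lamP : is_lebesgue lam).
Hypotheses (mA : measurable A) (p0 : 0 < peakless_const N lam A c).

Local Notation V := (fine (lam (nball N 0 1))).
Local Notation p := (peakless_const N lam A c).

Lemma peakless_const_le x t : A x -> 0 < t -> t <= N (x - c) ->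
  p <= fine (lam (nball N x t `&` A)) / fine (lam (nball N x t)).
Proof.
move=> Ax t0 tx; apply: ge_inf; last by exists x, t.
by exists 0 => _ [y [u [_ _ _ ->]]]; rewrite divr_ge0 ?fine_ge0.
Qed.

Lemma fine_nball x t : 0 < t -> fine (lam (nball N x t)) = t ^+ d * V.
Proof.
move=> t0; rewrite (lebesgue_nball NP)//.
case: (lam (nball N 0 1)) => [v|/=|/=] //; rewrite ?mulr0.
  by rewrite gt0_muley// lte_fin exprn_gt0.
by rewrite gt0_muleNy// lte_fin exprn_gt0.
Qed.

(** If V were 0, any quotient in the infimum would be a division by 0, hence 0, against p > 0. If
    there are no quotients at all, the infimum of the empty set is 0 by convention, again against p
    > 0. *)
Lemma peakless_nball_gt0 : 0 < V.
Proof.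
have [[x [t [Ax t0 tx]]]|H] :=
    pselect (exists x t, [/\ A x, 0 < t & t <= N (x - c)]).
  have := lt_le_trans p0 (peakless_const_le Ax t0 tx).
  rewrite fine_nball// => H; rewrite lt_neqAle fine_ge0// andbT.
  by apply/eqP => V0; move: H; rewrite -V0 mulr0 invr0 mulr0 ltxx.
suff : p = 0 by move=> pE; move: p0; rewrite pE ltxx.
rewrite /peakless_const (_ : [set _ | _] = set0) ?inf0//.
by apply/seteqP; split => // q [x [t [? ? ? _]]]; apply: H; exists x, t.
Qed.

Lemma peakless_lower x t : A x -> 0 < t -> t <= N (x - c) ->
  ((p * (t ^+ d * V))%:E <= lam (nball N x t `&` A))%E.
Proof.
move=> Ax t0 tx; have V0 := peakless_nball_gt0.
have B0 : 0 < fine (lam (nball N x t)).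
  by rewrite fine_nball// mulr_gt0// exprn_gt0.
(* A positive [fine] rules out an infinite value. *)
have Bfin : lam (nball N x t) \is a fin_num.
  by case: (lam (nball N x t)) B0 => //=; rewrite ltxx.
have BAfin : lam (nball N x t `&` A) \is a fin_num.
  rewrite ge0_fin_numE//; apply: (@le_lt_trans _ _ (lam (nball N x t))).
    rewrite le_measure// ?inE//; last exact: measurable_nball.
    by apply: measurableI => //; exact: measurable_nball.
  by rewrite ltey_eq Bfin.
rewrite -(fineK BAfin) lee_fin -(fine_nball x t0) -ler_pdivlMr//.
exact: peakless_const_le.
Qed.

End peakless.

Lemma measurable_powR_comp (R : realType) (d' : measure_display)
    (T : measurableType d') (f : T -> R) (q : R) :
  measurable_fun setT f -> measurable_fun setT (fun x => f x `^ q).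
Proof. exact: (@measurableT_comp _ _ _ _ _ _ (@powR R ^~ q)). Qed.

(** * Mass of small balls under an almost radial density *)

Section radial_mass.
Context {R : realType} {d : nat} (N N0 : 'rV[R]_d -> R).
Context (lam : {measure set (Rd R d) -> \bar R}) (A : set (Rd R d)).
Context (c : 'rV[R]_d) (h : Rd R d -> R) (M C0 al : R).
Hypotheses (d_gt0 : (0 < d)%N) (NP : is_norm N) (lamP : is_lebesgue lam).
Hypotheses (mA : measurable A) (p0 : 0 < peakless_const N lam A c).
Hypotheses (starA : star_shaped A c) (mh : measurable_fun setT h).
Hypotheses (h0 : forall x, 0 <= h x) (N0P : is_norm N0) (M0 : 0 <= M).
Hypotheses (radh : almost_radial_nonincr h A c N0 M) (C1 : 1 <= C0).
Hypotheses (NN0 : forall x, N0 x / C0 <= N x /\ N x <= C0 * N0 x).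
Hypotheses (al0 : 0 <= al).

Local Notation V := (fine (lam (nball N 0 1))).
Local Notation p := (peakless_const N lam A c).

(* Moving the centre of the ball of radius [eps * D] from [y] towards [c] gives
   a smaller ball of comparable radius on which [h] is at least [M * h y]. *)
Lemma shifted_ball (y : 'rV[R]_d) (eps D : R) : A y ->
  0 < eps < 3^-1 -> 0 < D -> D <= N (y - c) ->
  exists x : 'rV[R]_d, [/\ A x,
    eps * D / (2 * C0 ^+ 2) <= N (x - c) &
    forall z, A z -> N (z - x) <= eps * D / (2 * C0 ^+ 2) ->
      N (z - y) <= eps * D /\ M * h y <= h z].
Proof.
move=> Ay /andP[e0 e3] D0 DL; set L := N (y - c) in DL *.
have L0 : 0 < L by exact: lt_le_trans DL.
have C0p : 0 < C0 by exact: lt_le_trans C1.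
set t := eps * D / (2 * C0 ^+ 2).
have t0 : 0 < t by rewrite divr_gt0 ?mulr_gt0// exprn_gt0.
have tE : C0 ^+ 2 * t = eps * D / 2 by rewrite /t; field; rewrite gt_eqF.
have eDL : eps * D <= 3^-1 * L by rewrite ler_pM// ltW.
have C2 : 1 <= C0 ^+ 2 by rewrite exprn_ege1.
have tC : t <= C0 ^+ 2 * t by apply: ler_peMl => //; exact: ltW.
(* The centre moves by the [N]-distance s L = C0^2 t = eps D / 2. As t is at most that, the ball of
   radius t around [x] stays within distance eps D of [y]; as eps D <= L / 3, it avoids [c]. *)
pose s := C0 ^+ 2 * t / L.
have sL : s * L = C0 ^+ 2 * t by rewrite /s divfK ?gt_eqF.
have s0 : 0 <= s by rewrite /s divr_ge0 ?(ltW L0)// tE; have := mulr_gt0 e0 D0; lra.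
have s1 : s <= 1 by rewrite /s ler_pdivrMr// mul1r tE; lra.
pose x := c + (1 - s) *: (y - c).
have xc : x - c = (1 - s) *: (y - c) by rewrite /x addrC addKr.
have xy : x - y = (- s) *: (y - c).
  by rewrite /x scalerBl scale1r addrA addrCA subrr addr0 scaleNr [LHS]addrC addKr.
have Nxc : N (x - c) = L - s * L.
  by rewrite xc is_normZ// ger0_norm ?subr_ge0// -/L; ring.
exists x; split.
- by apply: starA => //; lra.
- by rewrite Nxc sL; lra.
move=> z Az zx; split.
  apply: (le_trans (is_norm_tri NP x _ _)).
  by rewrite xy is_normZ// normrN ger0_norm// -/L sL; lra.
apply: radh => //.
- by move=> yc; move: L0; rewrite /L yc subrr is_norm0// ltxx.
- move=> zc; move: zx; rewrite zc is_normB// Nxc sL; lra.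
(* In [N0], moving the centre gains s N0(y - c), and the ball loses at most C0 t. The gain suffices
   because s L = C0^2 t and L <= C0 N0(y - c); hence the square of C0. *)
apply: (le_trans (is_norm_tri N0P x _ _)).
rewrite xc is_normZ// ger0_norm ?subr_ge0//.
have [+ _] := NN0 (z - x); rewrite ler_pdivrMr// => zx0.
have [_ yL] := NN0 (y - c).
have : C0 * t <= s * N0 (y - c).
  rewrite -(ler_pM2l C0p) mulrA -expr2 -sL mulrCA ler_wpM2l//.
have : N (z - x) * C0 <= t * C0 by rewrite ler_pM2r.
lra.
Qed.

(** On the part of the shifted ball inside [A] the density is at least M h(y), and peaklessness
    bounds the volume of that part from below. The condition D <= N (y - c) will hold because [c] is
    the first point of the sequence. *)
Lemma radial_mass_lower (y : 'rV[R]_d) (eps D : R) : A y ->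
  0 < eps < 3^-1 -> 0 <= D -> D <= N (y - c) ->
  (((M * h y) `^ al * (p * ((eps * D / (2 * C0 ^+ 2)) ^+ d * V)))%:E <=
   \int[lam]_x ((h x) `^ al * \1_(nball N y (eps * D)) x)%:E)%E.
Proof.
move=> Ay e3; rewrite le_eqVlt => /predU1P[<- _|D0 DL].
  (* For D = 0 the left side vanishes, as 0^d = 0 for d > 0. *)
  rewrite mulr0 mul0r expr0n gtn_eqF// mul0r !mulr0 integral_ge0// => x _.
  by rewrite lee_fin mulr_ge0 ?powR_ge0.
have [x [Ax tx H]] := shifted_ball Ay e3 D0 DL.
set t := eps * D / _ in tx H *.
have t0 : 0 < t.
  have C0p : 0 < C0 by exact: lt_le_trans C1.
  by case/andP: e3 => e0 _; rewrite /t divr_gt0// mulr_gt0// exprn_gt0.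
have mB : measurable (nball N x t `&` A).
  by apply: measurableI => //; exact: measurable_nball.
apply: (@le_trans _ _
    (\int[lam]_z (((M * h y) `^ al)%:E * (\1_(nball N x t `&` A) z)%:E))%E).
  rewrite ge0_integralZl_EFin ?powR_ge0//; last exact/measurable_EFinP.
  rewrite integral_indic// setIT EFinM lee_wpmul2l ?lee_fin ?powR_ge0//.
  exact: peakless_lower.
apply: ge0_le_integral => //.
- by move=> z _; rewrite -EFinM lee_fin mulr_ge0 ?powR_ge0.
- apply/measurable_EFinP; apply: measurable_funM => //.
- apply/measurable_EFinP; apply: measurable_funM => //.
    exact: measurable_powR_comp.
  by apply: measurable_indic; exact: measurable_nball.
move=> z _; rewrite -EFinM lee_fin !indicE.
have [/set_mem[zx Az]|_] := boolP (z \in nball N x t `&` A); last first.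
  by rewrite mulr0 mulr_ge0 ?powR_ge0.
have [zy hz] := H z Az zx.
rewrite (_ : z \in nball N y (eps * D)) ?mulr1; last by rewrite inE.
by apply: ge0_ler_powR => //; rewrite nnegrE// mulr_ge0.
Qed.

End radial_mass.

(** * Integrals *)

Section tonelli.
Context {R : realType} {d : measure_display} {T : measurableType d}.
Context (mu : {measure set T -> \bar R}) (muT : sigma_finite setT mu).
Context (f : T * T -> \bar R) (mf : measurable_fun setT f).
Context (f0 : forall z, (0 <= f z)%E).

(** Bundles the hypothesis [muT] with [mu], so that Tonelli's theorem applies. *)
Let mu' : {sigma_finite_measure set T -> \bar R} :=
  HB.pack_for {sigma_finite_measure set T -> \bar R} (Measure.sort mu)
    (isSFinite.Build _ _ _ (Measure.sort mu) (sfinite_measure_sigma_finite muT))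
    (isSigmaFinite.Build _ _ _ (Measure.sort mu) muT).

Lemma tonelli_sigma_finite :
  (\int[mu]_x \int[mu]_y f (x, y) = \int[mu]_y \int[mu]_x f (x, y))%E.
Proof. exact: (@fubini_tonelli _ _ _ _ _ mu' mu'). Qed.

Lemma measurable_integral_sigma_finite :
  measurable_fun setT (fun x => \int[mu]_y f (x, y))%E.
Proof. exact: (@measurable_fun_fubini_tonelli_F _ _ _ _ _ mu'). Qed.

Lemma measurable_integral_sigma_finite_swap :
  measurable_fun setT (fun y => \int[mu]_x f (x, y))%E.
Proof. exact: (@measurable_fun_fubini_tonelli_G _ _ _ _ _ mu'). Qed.

End tonelli.

(** Hoelder's inequality for F^th and G^(1 - th) with conjugate exponents 1 / th and 1 / (1 -
    th). *)
Lemma hoelder_interpolation (R : realType) (d : measure_display)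
    (T : measurableType d) (mu : {measure set T -> \bar R}) (F G : T -> R)
    (th : R) : measurable_fun setT F -> measurable_fun setT G ->
  (forall x, 0 <= F x) -> (forall x, 0 <= G x) -> 0 < th < 1 ->
  (\int[mu]_x (F x `^ th * G x `^ (1 - th))%:E <=
   (\int[mu]_x (F x)%:E) `^ th * (\int[mu]_x (G x)%:E) `^ (1 - th))%E.
Proof.
move=> mF mG F0 G0 /andP[th0 th1].
have t0 : 0 < 1 - th by rewrite subr_gt0.
have := @hoelder _ T R mu (fun x => F x `^ th) (fun x => G x `^ (1 - th))
  th^-1 (1 - th)^-1 (measurable_powR_comp _ mF) (measurable_powR_comp _ mG).
rewrite !invr_gt0 !invrK => /(_ th0 t0); rewrite addrC subrK => /(_ erefl).
rewrite !unlock !invrK !invr1 => H.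
have E (K : T -> R) (q : R) : (forall x, 0 <= K x) -> 0 < q ->
    (\int[mu]_x (`|(EFin \o (fun x => (K x `^ q)%R)) x| `^ q^-1) =
     \int[mu]_x (K x)%:E)%E.
  move=> K0 q0; apply: eq_integral => x _ /=.
  by rewrite ger0_norm ?powR_ge0// -powRrM divff ?gt_eqF// powRr1.
rewrite !E// in H; apply: le_trans H.
rewrite poweRe1; last by apply: integral_ge0 => x _; exact: poweR_ge0.
rewrite le_eqVlt; apply/orP; left; apply/eqP; apply: eq_integral => x _ /=.
by rewrite ger0_norm ?mulr_ge0 ?powR_ge0// powRr1// mulr_ge0 ?powR_ge0.
Qed.

(** * Greedy sequences *)

Section greedy.
Context {R : realType} {d : nat} (r : R) (N : 'rV[R]_d -> R).
Context (lam : {measure set (Rd R d) -> \bar R}) (h : Rd R d -> R).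
Context (a : nat -> 'rV[R]_d) (eps al : R).
Hypotheses (r0 : 0 < r) (NP : is_norm N) (lamP : is_lebesgue lam).
Hypotheses (mh : measurable_fun setT h) (h0 : forall x, 0 <= h x).
Hypotheses (h1 : (\int[lam]_x (h x)%:E = 1)%E).
Hypotheses (hr : (\int[lam]_x ((N x) `^ r * h x)%:E < +oo)%E).
Hypotheses (ga : greedy_seq N lam h r a) (e0 : 0 < eps) (e1 : eps < 1).

(** The index is shifted so that the list is never empty: n.+1 points are used, the first being
    [a 0]. *)
Let D n (y : Rd R d) : R := distN N y (apref a n.+1).
(** Pairs of a candidate and a point y to which the candidate is closer than the current points by
    the factor eps. Being a subset of the product, it has an indicator to which Tonelli applies. *)
Let E n : set (Rd R d * Rd R d) :=
  [set z | N ((z.1 : 'rV[R]_d) - (z.2 : 'rV[R]_d)) <= eps * D n z.2].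

(** The r-th power of the error of the first n.+1 points. *)
Definition distortion n : \bar R :=
  \int[lam]_y (distN N y (apref a n.+1) `^ r * h y)%:E.
Local Notation u := distortion.

Let D0 n y : 0 <= D n y. Proof. exact: distN_ge0. Qed.

Let mD n : measurable_fun setT (D n). Proof. exact: measurable_distN. Qed.

Let mDrh n : measurable_fun setT (fun y => D n y `^ r * h y).
Proof. by apply: measurable_funM => //; exact: measurable_powR_comp. Qed.

Let Drh0 n y : 0 <= D n y `^ r * h y.
Proof. by rewrite mulr_ge0 ?powR_ge0. Qed.

Let mE n : measurable (E n).
Proof.
rewrite /E -[X in measurable X]setTI; apply: measurable_fun_le => //.
  exact: measurable_is_normB.
apply: measurable_funM => //.
exact: (measurableT_comp (mD n) measurable_snd).
Qed.

Let e10 : 0 <= 1 - eps `^ r.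
Proof.
rewrite subr_ge0 [leRHS](_ : 1 = 1 `^ r); last by rewrite powR1.
by rewrite ge0_ler_powR ?nnegrE ?(ltW r0) ?(ltW e0) ?(ltW e1).
Qed.

Lemma distortion_ge0 n : (0 <= u n)%E.
Proof. by apply: integral_ge0 => y _; rewrite lee_fin Drh0. Qed.

(** D(y) is at most N(y) + N(a_1), so D^r <= 2^r (N(y)^r + N(a_1)^r); the r-th moment is finite and
    the total mass is 1. *)
Lemma distortion_lty n : (u n < +oo)%E.
Proof.
apply: (@le_lt_trans _ _ (\int[lam]_y ((2 `^ r)%:E * ((N y `^ r * h y)%:E +
    (N (a 0%N) `^ r)%:E * (h y)%:E)))%E).
  apply: ge0_le_integral => //.
  - by move=> y _; rewrite lee_fin Drh0.
  - by apply/measurable_EFinP; exact: mDrh.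
  - apply/measurable_EFinP; apply: measurable_funM => //.
    apply: measurable_funD; apply: measurable_funM => //.
    by apply: measurable_powR_comp; exact: measurable_is_norm.
  move=> y _; rewrite -!EFinM lee_fin -mulrDl mulrA ler_wpM2r//.
  have Na : D n y <= 2 * Num.max (N y) (N (a 0%N)).
    apply: (@le_trans _ _ (N y + N (a 0%N))).
      apply: (le_trans (distN_le_head _ _ _ _)).
      by apply: (le_trans (is_normD NP _ _)); rewrite is_normN.
    have : N y <= Num.max (N y) (N (a 0%N)) by rewrite le_max lexx.
    have : N (a 0%N) <= Num.max (N y) (N (a 0%N)) by rewrite le_max lexx orbT.
    by lra.
  have m0 : 0 <= Num.max (N y) (N (a 0%N)) by rewrite le_max is_norm_ge0.
  apply: (@le_trans _ _ ((2 * Num.max (N y) (N (a 0%N))) `^ r)).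
    apply: (ge0_ler_powR (ltW r0)) Na; rewrite nnegrE; first exact: D0.
    by rewrite mulr_ge0.
  rewrite powRM// ler_wpM2l ?powR_ge0//.
  by case: (leP (N y) (N (a 0%N))) => _; rewrite ?lerDl ?lerDr powR_ge0.
rewrite ge0_integralZl_EFin ?powR_ge0//; last 2 first.
- by move=> y _; rewrite adde_ge0// -?EFinM lee_fin ?mulr_ge0 ?powR_ge0.
- apply/measurable_EFinP; apply: measurable_funD; apply: measurable_funM => //.
  by apply: measurable_powR_comp; exact: measurable_is_norm.
rewrite ge0_integralD//; last 4 first.
- by move=> y _; rewrite lee_fin mulr_ge0 ?powR_ge0.
- apply/measurable_EFinP; apply: measurable_funM => //.
  by apply: measurable_powR_comp; exact: measurable_is_norm.
- by move=> y _; rewrite -EFinM lee_fin mulr_ge0 ?powR_ge0.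
- by apply/measurable_EFinP; apply: measurable_funM.
rewrite ge0_integralZl_EFin ?powR_ge0//; last 2 first.
- by move=> y _; rewrite lee_fin.
- exact/measurable_EFinP.
by rewrite h1 mule1 lte_mul_pinfty ?lee_fin ?powR_ge0// lte_add_pinfty ?ltry.
Qed.

Lemma greedy_le n (z : 'rV[R]_d) : (u n.+1 <=
  \int[lam]_y ((Num.min (D n y) (N ((y : 'rV[R]_d) - z))) `^ r * h y)%:E)%E.
Proof.
have I0 (G : seq 'rV[R]_d) : (0 <= \int[lam]_y (distN N y G `^ r * h y)%:E)%E.
  by apply: integral_ge0 => y _; rewrite lee_fin mulr_ge0 ?powR_ge0.
have rn0 : r != 0 by rewrite gt_eqF.
have pos (x : \bar R) : (0 <= x)%E -> x \in `[0%E, +oo%E].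
  by move=> x0; rewrite in_itv/= x0 leey.
have powK (x : \bar R) : (0 <= x)%E -> ((x `^ r^-1) `^ r = x)%E.
  by move=> x0; rewrite -poweRrM mulVf// poweRe1.
have mono (x y : \bar R) : (0 <= x -> 0 <= y -> x `^ r^-1 <= y `^ r^-1 -> x <= y)%E.
  move=> x0 y0 /(gt0_ler_poweR (ltW r0) (pos _ (poweR_ge0 _ _)) (pos _ (poweR_ge0 _ _))).
  by rewrite !powK.
(* Greediness at index n.+1 concerns the choice of the point after the first n.+1; [mono] strips the
   r-th roots. *)
apply: (le_trans (mono _ _ (I0 _) (I0 _) (ga n.+1 z))).
rewrite le_eqVlt; apply/orP; left; apply/eqP; apply: eq_integral => y _.
by rewrite (distN_rcons N y (a 0%N) (map a (iota 1 n)) z).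
Qed.

(** Adding z replaces D^r by at most eps^r D^r on the section of [E n] at z and never increases it
    elsewhere. *)
Lemma greedy_gain n (z : Rd R d) :
  (u n.+1 + (1 - eps `^ r)%:E *
     \int[lam]_y (D n y `^ r * h y * \1_(E n) (z, y))%:E <= u n)%E.
Proof.
have mEz : measurable_fun setT (fun y => \1_(E n) (z, y) : R).
  have mI : measurable_fun setT (\1_(E n) : _ -> R) by exact: measurable_indic.
  exact: (measurable_fun_pair2 z mI).
have mmin : measurable_fun setT (fun y : Rd R d =>
    Num.min (D n y) (N ((y : 'rV[R]_d) - (z : 'rV[R]_d))) `^ r * h y).
  apply: measurable_funM => //; apply: measurable_powR_comp.
  by apply: measurable_minr => //; exact: measurable_is_normB.
rewrite -ge0_integralZl_EFin//; last 2 first.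
- by move=> y _; rewrite lee_fin mulr_ge0.
- by apply/measurable_EFinP; apply: measurable_funM.
apply: (le_trans (leeD2r _ (greedy_le n z))).
rewrite -ge0_integralD//; last 4 first.
- by move=> y _; rewrite lee_fin mulr_ge0 ?powR_ge0.
- exact/measurable_EFinP.
- by move=> y _; rewrite -EFinM lee_fin !mulr_ge0 ?powR_ge0.
- by apply/measurable_EFinP; do 2 apply: measurable_funM => //.
apply: ge0_le_integral => //.
- by move=> y _; rewrite adde_ge0// -?EFinM lee_fin !mulr_ge0 ?powR_ge0.
- apply/measurable_EFinP; apply: measurable_funD => //.
  by do 2 apply: measurable_funM => //.
- by apply/measurable_EFinP; exact: mDrh.
move=> y _; rewrite -EFinM -EFinD lee_fin indicE.
have [/set_mem/= zE|_] := boolP ((z, y) \in E n); last first.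
  rewrite !mulr0 addr0 ler_wpM2r//; apply: (ge0_ler_powR (ltW r0)).
  - by rewrite nnegrE le_min D0 is_norm_ge0.
  - exact: D0.
  - by rewrite ge_min lexx.
rewrite mulr1 mulrA -mulrDl ler_wpM2r// mulrBl mul1r.
suff : Num.min (D n y) (N ((y : 'rV[R]_d) - (z : 'rV[R]_d))) `^ r <=
    eps `^ r * D n y `^ r by lra.
rewrite -powRM ?(ltW e0)//; apply: (ge0_ler_powR (ltW r0)).
- by rewrite nnegrE le_min D0 is_norm_ge0.
- by rewrite nnegrE mulr_ge0 ?(ltW e0).
- by rewrite ge_min is_normB// zE orbT.
Qed.

Let Eball n x y : \1_(E n) (x, y) = \1_(nball N y (eps * D n y)) x :> R.
Proof. by rewrite !indicE; congr (_ %:R); apply/idP/idP; rewrite !inE. Qed.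

Let hal0 x : 0 <= h x `^ al. Proof. exact: powR_ge0. Qed.

Let mhal : measurable_fun setT (fun x => h x `^ al).
Proof. exact: measurable_powR_comp. Qed.

(** Average of [greedy_gain] over z with weight h(z)^al, after exchanging integrals. The additive
    form avoids subtracting extended reals: Z is allowed to be infinite here. *)
Lemma greedy_tonelli n (Z := (\int[lam]_x (h x `^ al)%:E)%E) :
  (u n.+1 * Z + (1 - eps `^ r)%:E *
    \int[lam]_y ((D n y `^ r * h y)%:E *
       \int[lam]_x (h x `^ al * \1_(nball N y (eps * D n y)) x)%:E)
    <= u n * Z)%E.
Proof.
have gain := greedy_gain n; move: (distortion_ge0 n.+1) (distortion_ge0 n) gain.
move: (u n.+1) (u n) => u1 u0 u1_ge0 u0_ge0 gain.
pose k (z : Rd R d * Rd R d) : \bar R :=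
  (h z.1 `^ al * (D n z.2 `^ r * h z.2 * \1_(E n) z))%:E.
have mI : measurable_fun setT (\1_(E n) : _ -> R) by exact: measurable_indic.
have mk : measurable_fun setT k.
  apply/measurable_EFinP; apply: measurable_funM.
    exact: (measurableT_comp mhal measurable_fst).
  apply: measurable_funM => //.
  exact: (measurableT_comp (mDrh n) measurable_snd).
have k0 z : (0 <= k z)%E by rewrite lee_fin !mulr_ge0 ?powR_ge0.
have lamT := lebesgue_sigma_finite lamP.
have mIz (z : Rd R d) : measurable_fun setT (fun y => \1_(E n) (z, y) : R).
  exact: (measurable_fun_pair2 z mI).
have mFk := measurable_integral_sigma_finite lamT mk k0.
have e1E0 : (0 <= (1 - eps `^ r)%:E)%E by rewrite lee_fin.
have Ik0 x : (0 <= \int[lam]_y k (x, y))%E by exact: integral_ge0.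
have EZ (c : \bar R) : (0 <= c)%E ->
    (c * Z = \int[lam]_x (c * (h x `^ al)%:E))%E.
  move=> c0; rewrite ge0_integralZl//; first exact/measurable_EFinP.
  by move=> x _; rewrite lee_fin.
have -> : (\int[lam]_y ((D n y `^ r * h y)%:E *
       \int[lam]_x (h x `^ al * \1_(nball N y (eps * D n y)) x)%:E) =
     \int[lam]_x \int[lam]_y k (x, y))%E.
  rewrite (tonelli_sigma_finite lamT mk k0); apply: eq_integral => y _.
  rewrite -ge0_integralZl_EFin//; last 2 first.
  - by move=> x _; rewrite lee_fin mulr_ge0.
  - apply/measurable_EFinP; apply: measurable_funM => //.
    by apply: measurable_indic; exact: measurable_nball.
  by apply: eq_integral => x _; rewrite /k -EFinM /= Eball mulrCA.
rewrite (EZ _ u1_ge0) (EZ _ u0_ge0).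
rewrite -(ge0_integralZl_EFin lam measurableT (fun x _ => Ik0 x) mFk e10).
have mu' (c : \bar R) : measurable_fun setT (fun x => c * (h x `^ al)%:E)%E.
  apply: emeasurable_funM; first exact: measurable_cst.
  exact/measurable_EFinP.
have mk' : measurable_fun setT
    (fun x => (1 - eps `^ r)%:E * \int[lam]_y k (x, y))%E.
  by apply: emeasurable_funM; first exact: measurable_cst.
rewrite -ge0_integralD//; last 2 first.
- by move=> x _; rewrite mule_ge0 ?lee_fin.
- by move=> x _; rewrite mule_ge0.
apply: ge0_le_integral => //.
- by move=> x _; rewrite adde_ge0 ?mule_ge0 ?lee_fin.
- exact: emeasurable_funD.
move=> x _.
(* With the weight factored out, the integrands compare pointwise by [greedy_gain] at x. *)
have -> : (\int[lam]_y k (x, y) = (h x `^ al)%:E *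
    \int[lam]_y (D n y `^ r * h y * \1_(E n) (x, y))%:E)%E.
  rewrite -ge0_integralZl_EFin//.
  - by move=> y _; rewrite lee_fin mulr_ge0.
  - by apply/measurable_EFinP; apply: measurable_funM.
set J := (\int[lam]_y _)%E.
have J0 : (0 <= J)%E by apply: integral_ge0 => y _; rewrite lee_fin mulr_ge0.
have -> : (u1 * (h x `^ al)%:E + (1 - eps `^ r)%:E * ((h x `^ al)%:E * J) =
    (h x `^ al)%:E * (u1 + (1 - eps `^ r)%:E * J))%E.
  rewrite [RHS]ge0_muleDr ?mule_ge0//.
  by rewrite (muleC u1) [in LHS]muleCA.
rewrite (muleC u0); apply: lee_wpmul2l; first by rewrite lee_fin.
exact: gain.
Qed.

(** The radius varies with y, so measurability comes from viewing the mass as a partial integral of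
    the jointly measurable indicator of [E n]. *)
Lemma measurable_ball_mass n : measurable_fun setT (fun y : Rd R d =>
  \int[lam]_x (h x `^ al * \1_(nball N y (eps * D n y)) x)%:E)%E.
Proof.
pose k (z : Rd R d * Rd R d) : \bar R := (h z.1 `^ al * \1_(E n) z)%:E.
have mk : measurable_fun setT k.
  apply/measurable_EFinP; apply: measurable_funM; last exact: measurable_indic.
  exact: (measurableT_comp mhal measurable_fst).
have k0 z : (0 <= k z)%E by rewrite lee_fin mulr_ge0.
rewrite [X in measurable_fun _ X](_ : _ =
    fun y => (\int[lam]_x k (x, y))%E); last first.
  by apply/funext => y; apply: eq_integral => x _; rewrite /k Eball.
exact: (measurable_integral_sigma_finite_swap (lebesgue_sigma_finite lamP) mk k0).
Qed.

End greedy.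

(** * The one-step inequality for an almost radial density *)

Section greedy_radial.
Context {R : realType} {d : nat} (r : R) (N N0 : 'rV[R]_d -> R).
Context (lam : {measure set (Rd R d) -> \bar R}) (h : Rd R d -> R).
Context (a : nat -> 'rV[R]_d) (A : set (Rd R d)) (M C0 : R).
Hypotheses (d0 : (0 < d)%N) (r0 : 0 < r).
Hypotheses (NP : is_norm N) (lamP : is_lebesgue lam).
Hypotheses (mh : measurable_fun setT h) (h0 : forall x, 0 <= h x).
Hypotheses (ga : greedy_seq N lam h r a) (mA : measurable A).
Hypotheses (suppA : supp lam h `<=` A) (starA : star_shaped A (a 0%N)).
Hypotheses (p0 : 0 < peakless_const N lam A (a 0%N)).
Hypotheses (N0P : is_norm N0) (M0 : 0 <= M).
Hypotheses (radh : almost_radial_nonincr h A (a 0%N) N0 M) (C1 : 1 <= C0).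
Hypotheses (NN0 : forall x, N0 x / C0 <= N x /\ N x <= C0 * N0 x).

Let al : R := d%:R / (d%:R + r).
Local Notation V := (fine (lam (nball N 0 1))).
Local Notation p := (peakless_const N lam A (a 0%N)).
Local Notation u := (distortion r N lam h a).
Local Notation D n y := (distN N y (apref a n.+1)).

Let dr0 : 0 < d%:R + r.
Proof. by rewrite ltr_wpDl. Qed.

Let al0 : 0 < al.
Proof. by rewrite divr_gt0// ltr0n. Qed.

(** Its power 1 / al is the norm of h in L^(d/(d+r)). *)
Definition density_mass : \bar R := \int[lam]_x (h x `^ al)%:E.

(** The integrand is D^r h times h^al D^d, the order of the ball mass in [radial_mass_lower]. *)
Definition mixed_moment n : \bar R :=
  \int[lam]_y (D n y `^ (r + d%:R) * h y `^ (1 + al))%:E.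

Let mDh n (q s : R) : measurable_fun setT
  (fun y : Rd R d => D n y `^ q * h y `^ s).
Proof.
apply: measurable_funM; apply: measurable_powR_comp => //.
exact: measurable_distN.
Qed.

(** Inserts the ball-mass bound of [radial_mass_lower] into [greedy_tonelli]. The bound is available
    on [A] only, hence the comparison almost everywhere. *)
Lemma greedy_step n (eps : R) : 0 < eps < 3^-1 ->
  (u n.+1 * density_mass +
   ((1 - eps `^ r) * (M `^ al * (p * ((eps / (2 * C0 ^+ 2)) ^+ d * V))))%:E *
     mixed_moment n <= u n * density_mass)%E.
Proof.
move=> e3; case/andP: (e3) => e0 e13.
have e1 : eps < 1 by lra.
apply: le_trans (greedy_tonelli al r0 NP lamP mh h0 ga e0 e1 n).
rewrite leeD2l// EFinM -muleA lee_wpmul2l//.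
  rewrite lee_fin subr_ge0 [leRHS](_ : 1 = 1 `^ r); last by rewrite powR1.
  by apply: (ge0_ler_powR (ltW r0)); rewrite ?nnegrE// ltW.
have c0 : 0 <= M `^ al * (p * ((eps / (2 * C0 ^+ 2)) ^+ d * V)).
  rewrite mulr_ge0 ?powR_ge0// mulr_ge0 ?(ltW p0)// mulr_ge0 ?fine_ge0//.
  by rewrite exprn_ge0// divr_ge0 ?mulr_ge0 ?exprn_ge0 ?(ltW e0)// (le_trans ler01).
rewrite -ge0_integralZl_EFin//; last 2 first.
- by move=> y _; rewrite lee_fin mulr_ge0 ?powR_ge0.
- by apply/measurable_EFinP; exact: mDh.
apply: ae_ge0_le_integral => //.
- by move=> y _; apply: mule_ge0; rewrite lee_fin// mulr_ge0 ?powR_ge0.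
- apply/measurable_EFinP; apply: measurable_funM => //; exact: mDh.
- move=> y _; rewrite mule_ge0 ?lee_fin ?mulr_ge0 ?powR_ge0//.
  by apply: integral_ge0 => x _; rewrite lee_fin mulr_ge0 ?powR_ge0.
- apply: emeasurable_funM; last exact: measurable_ball_mass.
  apply/measurable_EFinP; apply: measurable_funM => //.
  by apply: measurable_powR_comp; exact: measurable_distN.
(* Outside a null set, either y is in the support, hence in [A], or h(y) = 0 and both integrands
   vanish. *)
apply: negligibleS (supp_ae lam mh h0) => y /=; apply: contra_notP.
move=> /not_andP hy _; have {}hy : A y \/ h y = 0.
  by case: hy => [/contrapT /suppA|/contrapT]; [left|right].
have al1 : 1 + al != 0 by rewrite gt_eqF// addr_gt0.
have D0 := distN_ge0 NP y (apref a n.+1).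
case: hy => [Ay|->]; last first.
  by rewrite powR0// !mulr0 mule0 mul0e.
have := radial_mass_lower d0 NP lamP mA p0 starA mh h0 N0P M0 radh C1 NN0
  (ltW al0) Ay e3 D0 (distN_le_head _ _ _ _).
move=> /(@lee_wpmul2l _ ((D n y `^ r * h y)%:E)).
rewrite lee_fin mulr_ge0 ?powR_ge0// => /(_ isT); apply: le_trans.
rewrite -!EFinM lee_fin powRM// le_eqVlt; apply/orP; left; apply/eqP.
rewrite powRD; last by rewrite gt_eqF// addrC.
rewrite (@powRD _ (h y)); last by rewrite (negbTE al1).
rewrite powRr1// powR_mulrn// !exprMn.
ring.
Qed.

(** Interpolation with th = 1 - al = r / (d + r): the exponents match since (r + d)(1 - al) = r and
    (1 + al)(1 - al) + al^2 = 1. *)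
Lemma distortion_hoelder n :
  (u n <= mixed_moment n `^ (1 - al) * density_mass `^ al)%E.
Proof.
have al1 : 1 - al = r / (d%:R + r) by rewrite /al; field; rewrite gt_eqF.
have al1' : 0 < 1 - al by rewrite al1 divr_gt0.
have := @hoelder_interpolation R _ _ lam
  (fun y => D n y `^ (r + d%:R) * h y `^ (1 + al)) (fun y => h y `^ al)
  (1 - al) (mDh n _ _) (measurable_powR_comp al mh).
rewrite subKr => H; apply: le_trans (H _ _ _).
- rewrite le_eqVlt; apply/orP; left; apply/eqP; apply: eq_integral => y _.
  have al2 : (1 + al) * (1 - al) + al * al = 1 by ring.
  have al3 : (r + d%:R) * (1 - al) = r by rewrite al1; field; rewrite gt_eqF.
  congr EFin; rewrite powRM ?powR_ge0// -!powRrM -mulrA -powRD ?al2 ?oner_eq0//.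
  by rewrite al3 powRr1.
- by move=> y; rewrite mulr_ge0 ?powR_ge0.
- by move=> y; rewrite powR_ge0.
- by apply/andP; split => //; rewrite ltrBlDr ltrDl.
Qed.

End greedy_radial.

(** * From the recursion to the rate *)

(* [c] is the constant of [greedy_step]; replacing [1 - eps `^ r] by
   [3 `^ (- r) - eps `^ r] and [M `^ (d / (d + r))] by [M `^ (d * (d + r))]
   only weakens the bound. *)
Lemma rate_constant (R : realType) (d : nat) (r M C0 V p eps Z w : R) (k : nat)
  (al := d%:R / (d%:R + r))
  (c := (1 - eps `^ r) * (M `^ al * (p * ((eps / (2 * C0 ^+ 2)) ^+ d * V)))) :
  (0 < d)%N -> 0 < r -> 0 < M <= 1 -> 1 <= C0 -> 0 < V -> 0 < p ->
  0 < eps < 3^-1 -> 0 <= Z -> 0 < w -> (0 < k)%N ->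
  d%:R / r * k%:R <= Z `^ (1 + d%:R / r) / c * w `^ (- (d%:R / r)) ->
  w `^ r^-1 <=
    (2 * C0 ^+ 2 * r `^ (d%:R^-1)) /
      (d%:R `^ (d%:R^-1) * M `^ (d%:R + r) * V `^ (d%:R^-1) * p `^ (d%:R^-1))
    * phi_r d r eps `^ (- d%:R^-1) * (Z `^ al^-1) `^ r^-1 * k%:R `^ (- d%:R^-1).
Proof.
move=> d0 r0 /andP[M0 M1] C1 V0 p0 /andP[e0 e3] Z0 w0 k0 H.
have d0R : 0 < d%:R :> R by rewrite ltr0n.
have k0R : 0 < k%:R :> R by rewrite ltr0n.
have C0p : 0 < C0 by exact: lt_le_trans C1.
have er : eps `^ r < 3 `^ (- r).
  rewrite (_ : 3 `^ (- r) = 3^-1 `^ r); last first.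
    by rewrite -[in RHS]powR_inv1// -powRrM mulN1r.
  by apply: gt0_ltr_powR; rewrite ?nnegrE ?(ltW e0) ?invr_ge0.
have e3r : 3 `^ (- r) <= 1 :> R.
  have /ler_powR/(_ (- r) 0) : 1 <= 3 :> R by rewrite ler1n.
  by rewrite powRr0; apply; rewrite oppr_le0 ltW.
set T := (X in _ <= X).
have ph0 : 0 < phi_r d r eps by rewrite /phi_r mulr_gt0 ?subr_gt0// exprn_gt0.
have T0 : 0 <= T.
  have C2 : 0 <= C0 ^+ 2 by rewrite exprn_ge0 ?(ltW C0p).
  by rewrite /T; repeat first [exact: powR_ge0|exact: C2|exact: ler0n
    |apply: mulr_ge0|rewrite invr_ge0].
have rootK (x : R) : 0 <= x -> (x `^ d%:R^-1) ^+ d = x.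
  by move=> x0; rewrite -powR_mulrn ?powR_ge0// -powRrM mulVf ?powRr1 ?gt_eqF.
have rootNK (x : R) : 0 <= x -> (x `^ (- d%:R^-1)) ^+ d = x^-1.
  by move=> x0; rewrite powRN exprVn rootK.
have TE : T ^+ d = (2 * C0 ^+ 2) ^+ d * r /
    (d%:R * M `^ ((d%:R + r) * d%:R) * V * p) / phi_r d r eps
    * Z `^ (1 + d%:R / r) / k%:R.
  have alrd : al^-1 * (r^-1 * d%:R) = 1 + d%:R / r.
    by rewrite /al; field; rewrite !gt_eqF ?addr_gt0.
  rewrite /T !exprMn exprVn !exprMn !rootK ?(ltW r0, ltW V0, ltW p0, ltW d0R)//.
  rewrite !rootNK ?(ltW k0R, ltW ph0)//.
  by rewrite -!(powR_mulrn d (powR_ge0 _ _)) -!powRrM alrd.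
(* Comparing d-th powers removes the roots of order d from the constant. *)
suff wT : w `^ (d%:R / r) <= T ^+ d.
  have -> : w `^ r^-1 = (w `^ (d%:R / r)) `^ d%:R^-1.
    by rewrite -powRrM; congr (_ `^ _); field; rewrite !gt_eqF.
  have -> : T = (T ^+ d) `^ d%:R^-1.
    by rewrite -powR_mulrn// -powRrM divff ?gt_eqF// powRr1.
  by apply: ge0_ler_powR; rewrite ?nnegrE ?invr_ge0 ?powR_ge0 ?exprn_ge0 ?(ltW d0R).
have c0 : 0 < c.
  rewrite /c mulr_gt0//; first by rewrite subr_gt0 (lt_le_trans er).
  rewrite mulr_gt0 ?powR_gt0// mulr_gt0// mulr_gt0// exprn_gt0// divr_gt0//.
  by rewrite mulr_gt0// exprn_gt0.
have ws0 : 0 < w `^ (d%:R / r) by rewrite powR_gt0.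
have sk0 : 0 < d%:R / r * k%:R by rewrite mulr_gt0// divr_gt0.
move: H; rewrite powRN ler_pdivlMr// mulrC -ler_pdivlMr// => H.
apply: (le_trans H); rewrite TE.
set K := Z `^ _; have K0 : 0 <= K by exact: powR_ge0.
rewrite (_ : K / c / _ = K * (r / (d%:R * k%:R)) * c^-1); last first.
  by field; rewrite !gt_eqF.
rewrite [leRHS](_ : _ = K * (r / (d%:R * k%:R)) * ((2 * C0 ^+ 2) ^+ d /
    (M `^ ((d%:R + r) * d%:R) * V * p * phi_r d r eps))); last first.
  by field; rewrite !gt_eqF ?powR_gt0.
rewrite ler_wpM2l ?mulr_ge0 ?invr_ge0 ?mulr_ge0 ?(ltW r0) ?(ltW d0R) ?(ltW k0R)//.
rewrite -[leRHS]invrK lef_pV2 ?posrE//; last first.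
  rewrite invr_gt0; repeat first [done|exact: powR_gt0|apply: divr_gt0
    |apply: mulr_gt0|apply: exprn_gt0].
rewrite invf_div /c /phi_r expr_div_n.
have : 0 < (2 * C0 ^+ 2) ^+ d by rewrite exprn_gt0// mulr_gt0// exprn_gt0.
move: ((2 * C0 ^+ 2) ^+ d) => B B0; rewrite ler_pdivrMr//.
rewrite [leRHS](_ : _ = (M `^ al * (1 - eps `^ r)) * (V * p * eps ^+ d)); last first.
  by field; rewrite gt_eqF.
rewrite [leLHS](_ : _ = (M `^ ((d%:R + r) * d%:R) * (3 `^ (- r) - eps `^ r)) *
   (V * p * eps ^+ d)); last by ring.
rewrite ler_wpM2r//; first by rewrite !mulr_ge0 ?exprn_ge0 ?(ltW V0) ?(ltW p0) ?(ltW e0).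
apply: ler_pM; rewrite ?powR_ge0 ?subr_ge0 ?(ltW er) ?lerB//.
apply: ger_powR; first by rewrite M0.
(* Powers of M <= 1 decrease in the exponent, and al <= 1 <= (d + r) d. *)
apply: (@le_trans _ _ 1).
  by rewrite /al ler_pdivrMr ?addr_gt0// mul1r lerDl ltW.
have : 1 <= d%:R :> R by rewrite ler1n.
nra.
Qed.

(** Raising the Hoelder bound to the power 1 + s / r = 1 / (1 - al) gives u^(1 + s/r) <= I Z^(s/r),
    and the first inequality gives I <= (u - u') Z / c. *)
Lemma recursion_fine (R : realType) (s r c : R) (u u' Z I : \bar R)
    (al := s / (s + r)) : 0 < s -> 0 < r -> 0 < c ->
  (0 <= u)%E -> (u < +oo)%E -> (0 <= u')%E -> (u' < +oo)%E ->
  (0 <= Z)%E -> (Z < +oo)%E -> (0 <= I)%E ->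
  (u' * Z + c%:E * I <= u * Z)%E -> (u <= I `^ (1 - al) * Z `^ al)%E ->
  fine u `^ (1 + s / r) <=
    fine Z `^ (1 + s / r) / c * (fine u - fine u').
Proof.
move=> s0 r0 c0.
case: u => [u| |]//; case: u' => [u'| |]//; case: Z => [Z| |]//.
rewrite !lee_fin => u_ge0 _ u'_ge0 _ Z0 _.
(* I = +oo is excluded because u Z is finite and c > 0. *)
case: I => [I| |]//; last by rewrite gt0_muley ?lte_fin.
rewrite lee_fin => I0 E1 E2 /=.
have H1 : u' * Z + c * I <= u * Z by move: E1; rewrite -lee_fin.
have H2 : u <= I `^ (1 - al) * Z `^ al by move: E2; rewrite -lee_fin.
have sr : 0 < s + r by rewrite addr_gt0.
have q0 : 0 < 1 + s / r by rewrite addr_gt0// divr_gt0.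
have q1 : (1 - al) * (1 + s / r) = 1.
  by rewrite /al; field; rewrite !gt_eqF.
have q2 : al * (1 + s / r) = s / r.
  by rewrite /al; field; rewrite !gt_eqF.
apply: (@le_trans _ _ (I * Z `^ (s / r))).
  have /(ge0_ler_powR (ltW q0)) := H2.
  rewrite !nnegrE u_ge0 mulr_ge0 ?powR_ge0// => /(_ isT isT) /le_trans; apply.
  by rewrite powRM ?powR_ge0// -!powRrM q1 q2 powRr1.
rewrite (_ : Z `^ (1 + s / r) = Z * Z `^ (s / r)); last first.
  by rewrite powRD ?powRr1// gt_eqF.
rewrite [leRHS](_ : _ = ((u * Z - u' * Z) / c) * Z `^ (s / r)); last first.
  by field; rewrite gt_eqF.
rewrite ler_wpM2r ?powR_ge0// ler_pdivlMr//; lra.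
Qed.

Unset Implicit Arguments.

Theorem theorem2p8 (R : realType) (d : nat) (r : R)
  (N : 'rV[R]_d -> R) (lam : {measure set (Rd R d) -> \bar R})
  (h : Rd R d -> R) (a : nat -> 'rV[R]_d) (A : set (Rd R d))
  (N0 : 'rV[R]_d -> R) (M C0 : R) :
  (1 <= d)%N -> 0 < r -> is_norm N -> is_lebesgue lam ->
  measurable_fun setT h -> (forall x, 0 <= h x) ->
  (\int[lam]_x (h x)%:E = 1)%E ->
  (\int[lam]_x ((h x) `^ (d%:R / (d%:R + r)))%:E < +oo)%E ->
  (\int[lam]_x ((N x) `^ r * h x)%:E < +oo)%E ->
  greedy_seq N lam h r a ->
  measurable A ->
  supp lam h `<=` A -> A (a 0%N) ->
  star_shaped A (a 0%N) ->
  0 < peakless_const N lam A (a 0%N) ->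
  is_norm N0 -> 0 < M <= 1 -> almost_radial_nonincr h A (a 0%N) N0 M ->
  1 <= C0 -> (forall x, N0 x / C0 <= N x /\ N x <= C0 * N0 x) ->
  forall n : nat, (2 <= n)%N ->
    (err N lam h r (apref a n) <=
     ((2 * C0 ^+ 2 * r `^ (d%:R^-1)) /
        (d%:R `^ (d%:R^-1) * M `^ (d%:R + r)
         * (fine (lam (nball N 0 1))) `^ (d%:R^-1)
         * (peakless_const N lam A (a 0%N)) `^ (d%:R^-1))
      * inf [set (phi_r d r e) `^ (- d%:R^-1) | e in `]0, 3^-1[%classic])%:E
     * (Lnorm lam (d%:R / (d%:R + r))%:E (fun x => (h x)%:E)) `^ r^-1
     * (((n.-1)%:R : R) `^ (- d%:R^-1))%:E)%E.
Proof.
move=> d0 r0 NP lamP mh h0 h1 hal hr ga mA suppA _ starA p0 N0P M01 radh C1 NN0.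
(* With n = k0.+1, the distortion of the first n points has index k0 = n - 1, which is also the
   number of recursion steps taken from index 0. *)
case=> // k0 k2; have {k2} k0_gt0 : (0 < k0)%N by [].
have [M0 _] := andP M01.
have d0R : 0 < d%:R :> R by rewrite ltr0n.
have V0 := peakless_nball_gt0 NP lamP p0.
set p := peakless_const _ _ _ _ in p0 *; set V := fine _ in V0 *.
pose al : R := d%:R / (d%:R + r).
pose u := distortion r N lam h a.
have u_ge0 n : (0 <= u n)%E by exact: distortion_ge0.
have u_lty n : (u n < +oo)%E by exact: distortion_lty.
pose w n := fine (u n).
pose Z := fine (density_mass r lam h).
have Z_ge0 : (0 <= density_mass r lam h)%E.
  by apply: integral_ge0 => x _; rewrite lee_fin powR_ge0.
have ZE : density_mass r lam h = Z%:E by rewrite fineK// ge0_fin_numE.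
have w0 n : 0 <= w n by exact: fine_ge0.
have uE n : u n = (w n)%:E by rewrite fineK// ge0_fin_numE.
have -> : err N lam h r (apref a k0.+1) = ((w k0) `^ r^-1)%:E.
  by rewrite /err -[X in (X `^ _)%E]/(u k0) uE poweR_EFin.
have -> : Lnorm lam (d%:R / (d%:R + r))%:E (fun x => (h x)%:E) = (Z `^ al^-1)%:E.
  rewrite unlock -poweR_EFin -ZE; congr (_ `^ _)%E.
  by apply: eq_integral => x _; rewrite /= ger0_norm.
rewrite poweR_EFin -!EFinM lee_fin /=.
set X := (X in X * inf _); set S := [set _ | _ in _].
set Y := (Z `^ al^-1) `^ r^-1; set W := k0%:R `^ _.
have S0 : S !=set0.
  by exists (phi_r d r 4^-1 `^ (- d%:R^-1)), 4^-1 => //=; rewrite in_itv/=; lra.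
have X0 : 0 <= X.
  have C2 : 0 <= C0 ^+ 2 by rewrite exprn_ge0// (le_trans ler01).
  by rewrite /X; repeat first [exact: powR_ge0|exact: C2|exact: ler0n
    |apply: mulr_ge0|rewrite invr_ge0].
have Y0 : 0 <= Y by exact: powR_ge0.
have W0 : 0 <= W by exact: powR_ge0.
have infS0 : 0 <= inf S.
  by apply: lb_le_inf => // _ [e _ <-]; exact: powR_ge0.
(* The decay estimate needs w k0 > 0; otherwise the left side is 0. *)
have [w_eq0|w_gt0] := eqVneq (w k0) 0.
  by rewrite w_eq0 powR0 ?invr_eq0 ?gt_eqF//; do 3 apply: mulr_ge0 => //.
have {}w_gt0 : 0 < w k0 by rewrite lt_neqAle eq_sym w_gt0 w0.
have key e : 0 < e < 3^-1 ->
    w k0 `^ r^-1 <= X * (phi_r d r e `^ (- d%:R^-1)) * Y * W.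
  move=> e3; case/andP: (e3) => e0 e13.
  pose c := (1 - e `^ r) * (M `^ al * (p * ((e / (2 * C0 ^+ 2)) ^+ d * V))).
  have c0 : 0 < c.
    have : e `^ r < 1 `^ r by apply: gt0_ltr_powR => //; rewrite ?nnegrE; lra.
    rewrite powR1 /c -subr_gt0 => e1; rewrite mulr_gt0// mulr_gt0 ?powR_gt0//.
    rewrite mulr_gt0// mulr_gt0// exprn_gt0// divr_gt0// mulr_gt0// exprn_gt0//.
    exact: lt_le_trans C1.
  apply: rate_constant => //; first exact: fine_ge0.
  apply: (@recursive_decay _ (d%:R / r) (Z `^ (1 + d%:R / r) / c) w) => //.
  - by rewrite divr_gt0.
  - by rewrite divr_ge0 ?powR_ge0// ltW.
  move=> n; apply: (@recursion_fine _ d%:R r c (u n) (u n.+1)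
    (density_mass r lam h) (mixed_moment r N lam h a n)) => //.
  - by apply: integral_ge0 => y _; rewrite lee_fin mulr_ge0 ?powR_ge0.
  - exact: (greedy_step d0 r0 NP lamP mh h0 ga mA suppA starA p0 N0P (ltW M0)
      radh C1 NN0).
  - exact: distortion_hoelder.
(* Passing to the infimum divides by X Y W. It is nonzero by [key] itself: at eps = 1/4 a positive
   number is bounded by a multiple of it. *)
have XYW : 0 < X * Y * W.
  rewrite lt_neqAle (mulr_ge0 (mulr_ge0 X0 Y0) W0) andbT; apply/eqP => E0.
  have /key : 0 < (4^-1 : R) < 3^-1 by lra.
  rewrite (_ : X * _ * Y * W = X * Y * W * phi_r d r 4^-1 `^ (- d%:R^-1)); last by ring.
  by rewrite -E0 mul0r leNgt powR_gt0.
rewrite (_ : X * inf S * Y * W = X * Y * W * inf S); last by ring.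
rewrite -ler_pdivrMl//; apply: lb_le_inf => // _ [e /= + <-].
rewrite in_itv/= => e3; rewrite ler_pdivrMl//.
by rewrite [leRHS](_ : _ = X * phi_r d r e `^ (- d%:R^-1) * Y * W) ?key//; ring.
Qed.
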